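(* The linear map $\theta:\mathcal N(\sigma)\to\mathfrak g$ determined by $$\bar N_0(m)\mapsto L_{m-1},\qquad \bar N_i\bigl(m+\tfrac ip\bigr)\mapsto I_m^{(i)},\qquad \bar K_j(-1)\mapsto C_j\qquad\bigl(m\in\mathbb Z,\ 1\le i\le p-1,\ 0\le j\le\lfloor p/2\rfloor\bigr)$$ is a Lie algebra isomorphism. Furthermore, let $J\subseteq\{0,1,\dots,p-1\}$ be such that $p-i\in J$ whenever $i\in J\setminus\{0\}$, and put $J^*=J\setminus\{0\}$. Then $\theta$ restricts to an isomorphism $\theta_J=\theta|_{\mathcal N_J(\sigma_J)}:\mathcal N_J(\sigma_J)\to\mathfrak g_J$ when $J\neq J^*$ (i.e. $0\in J$), and to an isomorphism $\theta_J=\theta|_{\mathcal N_J(\sigma_J)}:\mathcal N_J(\sigma_J)\to\mathfrak h_J$ when $J=J^*$.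
   Context: All vector spaces and algebras are over $\mathbb C$; $p>1$ is a fixed integer. Gap-$p$ Virasoro algebra. $\mathfrak g$ is the Lie algebra with basis $\{L_n, I_n^{(i)}, C_j : n\in\mathbb Z, 1\le i\le p-1, 0\le j\le \lfloor p/2\rfloor\}$ and brackets $[L_m,L_n]=(m-n)L_{m+n}+\frac1{12}(m^3-m)\delta_{m+n,0}C_0$, $[I_m^{(i)},I_n^{(j)}]=(m+\frac ip)\delta_{i+j,p}\delta_{m+n+1,0}C_i$, $[L_m,I_n^{(i)}]=-(n+\frac ip)I_{m+n}^{(i)}$, all $C_k$ central; one sets $C_i:=C_{p-i}$ for $\lfloor p/2\rfloor<i\le p-1$. For $J$ as in the claim: if $0\in J$, $\mathfrak g_J:=\mathrm{Span}\{L_n,I_n^{(i)},C_0,C_i: n\in\mathbb Z,i\in J^*\}$; if $0\notin J$, $\mathfrak h_J:=\mathrm{Span}\{I_n^{(i)},C_i: n\in\mathbb Z,i\in J\}$. The Lie algebra $\mathcal N(\sigma)$ (a twist of a vertex Lie algebra) has basis $\{\bar N_i(m+\frac ip),\bar K_j(-1): m\in\mathbb Z,\ 0\le i\le p-1,\ 0\le j\le\lfloor p/2\rfloor\}$; set $\bar K_i(-1)=\bar K_{p-i}(-1)$ for $\lfloor p/2\rfloor<i\le p-1$, $\bar N_i(z)=\sum_{m\in\mathbb Z}\bar N_i(m+\frac ip)z^{-m-\frac ip-1}$, $\bar K_i(z)=\bar K_i(-1)z^0$, $\delta(x)=\sum_{n\in\mathbb Z}x^n$. The $\bar K_j(-1)$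 are central and, for $i,j=1,\dots,p-1$, $$[\bar N_0(z),\bar N_0(w)]=\Bigl(\tfrac{\partial}{\partial w}\bar N_0(w)\Bigr)z^{-1}\delta\bigl(\tfrac wz\bigr)+2\bar N_0(w)\tfrac{\partial}{\partial w}z^{-1}\delta\bigl(\tfrac wz\bigr)+\tfrac1{12}\bar K_0(w)\bigl(\tfrac{\partial}{\partial w}\bigr)^3z^{-1}\delta\bigl(\tfrac wz\bigr),$$ $$[\bar N_0(z),\bar N_i(w)]=\Bigl(\tfrac{\partial}{\partial w}\bar N_i(w)\Bigr)z^{-1}\delta\bigl(\tfrac wz\bigr)+\bar N_i(w)\tfrac{\partial}{\partial w}z^{-1}\delta\bigl(\tfrac wz\bigr),$$ $$[\bar N_i(z),\bar N_j(w)]=\delta_{i+j,p}\bar K_i(w)\tfrac{\partial}{\partial w}\Bigl(z^{-1}\bigl(\tfrac wz\bigr)^{\frac ip}\delta\bigl(\tfrac wz\bigr)\Bigr).$$ $\mathcal N_J(\sigma_J)$ is the subalgebra of $\mathcal N(\sigma)$ spanned by $\{\bar N_j(m+\frac jp),\bar K_j(-1): m\in\mathbb Z,j\in J\}$. *)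

(* Defs.v *)
From HB Require Import structures.
From mathcomp Require Import all_boot all_order all_algebra.
From mathcomp Require Import all_classical all_reals.
From mathcomp Require Import complex.

Set Implicit Arguments.
Unset Strict Implicit.
Unset Printing Implicit Defensive.

Import Order.TTheory GRing.Theory Num.Theory.

Local Open Scope classical_set_scope.
Local Open Scope ring_scope.

HB.mixin Record Lmodule_isLie (K : comNzRingType) L of GRing.Lmodule K L := {
  lie : L -> L -> L ;
  lie_linearl : forall y : L, linear (lie ^~ y) ;
  lie_linearr : forall x : L, linear (lie x) ;
  liexx : forall x : L, lie x x = 0 ;
  lie_jacobi : forall x y z : L,
    lie x (lie y z) + lie y (lie z x) + lie z (lie x y) = 0
}.

#[short(type="lieAlgType")]
HB.structure Definition Lie (K : comNzRingType) :=
  { L of GRing.Lmodule K L & Lmodule_isLie K L }.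

Notation "[` x , y ]" := (lie x y)
  (at level 0, x at level 99, y at level 99, format "[`  x ,  y ]") : ring_scope.

Section LinearAlgebra.
Context {K : comNzRingType} {V : lmodType K}.

Definition lspan (S : set V) : set V :=
  [set v | exists (n : nat) (c : 'I_n -> K) (s : 'I_n -> V),
      (forall k, S (s k)) /\ v = \sum_(k < n) c k *: s k].

Definition lfree (T : Type) (b : T -> V) : Prop :=
  forall (n : nat) (t : 'I_n -> T) (c : 'I_n -> K), injective t ->
    \sum_(k < n) c k *: b (t k) = 0 -> forall k, c k = 0.

Definition lbasis (T : Type) (b : T -> V) : Prop :=
  lfree b /\ lspan (range b) = setT.

End LinearAlgebra.

Section LieNotions.
Context {K : comNzRingType}.

Definition central (L : lieAlgType K) (c : L) : Prop :=
  forall x : L, [` c, x] = 0.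

Definition lie_subalgebra (L : lieAlgType K) (A : set L) : Prop :=
  [/\ A 0, (forall x y, A x -> A y -> A (x + y)),
      (forall (a : K) x, A x -> A (a *: x)) &
      (forall x y, A x -> A y -> A [` x, y])].

Definition lie_isomorphism (L M : lieAlgType K) (f : {linear L -> M}) : Prop :=
  (forall x y, f [` x, y] = [` f x, f y]) /\ bijective f.

(** [f] restricts to an isomorphism from the Lie algebra [A] onto the Lie
    algebra [B]; linearity of the restriction is inherited from [f]. *)
Definition restricts_to_lie_isomorphism (L M : lieAlgType K)
    (f : {linear L -> M}) (A : set L) (B : set M) : Prop :=
  [/\ lie_subalgebra A, lie_subalgebra B,
      (forall x y, A x -> A y -> f [` x, y] = [` f x, f y]) &
      set_bij A B f].

End LieNotions.

(** Formal series with rational exponents: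
    [a : rat -> V] stands for the formal series [\sum_q a q z^q], and
    [d : rat -> rat -> V] for [\sum_(q, r) d q r z^q w^r]. *)
Section FormalSeries.
Context {K : numFieldType}.
Implicit Types V : lmodType K.

(** The formal sum [\sum_(m : int) v m z^(e m)]. *)
Definition fsum V (e : int -> rat) (v : int -> V) : rat -> V :=
  fun q => \sum_(m \in [set m | e m = q]) v m.

(** The constant series [v z^0]. *)
Definition fconst V (v : V) : rat -> V := fun q => if q == 0 then v else 0.

Definition delta : rat -> K := @fsum K^o (fun n => n%:~R) (fun=> 1).

(** Substitution [x := w / z]. *)
Definition subst_wz (a : rat -> K) : rat -> rat -> K :=
  fun q r => if q == - r then a r else 0.

(** Multiplication by the monomial [z^s w^t]. *)
Definition mulmono (s t : rat) (d : rat -> rat -> K) : rat -> rat -> K :=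
  fun q r => d (q - s) (r - t).

Definition deriv1 V (a : rat -> V) : rat -> V :=
  fun r => ratr (r + 1) *: a (r + 1).

Definition deriv_w (d : rat -> rat -> K) : rat -> rat -> K :=
  fun q r => ratr (r + 1) * d q (r + 1).

(** The product [a(w) d(z, w)]. It only makes sense when, for all [q] and [r],
    finitely many summands are nonzero (otherwise the sum below is [0] by
    convention); this is so for every [d] considered here, because for fixed
    [q] the coefficient of [z^q] is then a monomial in [w]. *)
Definition mulw V (a : rat -> V) (d : rat -> rat -> K) : rat -> rat -> V :=
  fun q r => \sum_(t \in [set: rat]) d q t *: a (r - t).

(** The commutator [[a(z), b(w)]]. *)
Definition fbracket (L : lieAlgType K) (a b : rat -> L) : rat -> rat -> L :=
  fun q r => [` a q, b r].

(** [z^-1 (w/z)^s delta(w/z)] *)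
Definition delta_wz (s : rat) : rat -> rat -> K :=
  mulmono (-1) 0 (mulmono (- s) s (subst_wz delta)).

End FormalSeries.

Section GapVirasoro.
Context {K : numFieldType} (p : nat).

(** The convention [C_i := C_(p-i)] for [p/2 < i <= p-1], the given data being
    indexed by [0 <= j <= p/2]. *)
Definition fold_idx (T : Type) (C : nat -> T) (i : nat) : T :=
  if (i <= p./2)%N then C i else C (p - i)%N.

Definition pexp (i : nat) (m : int) : rat := m%:~R + i%:R / p%:R.

(** Families are indexed by all naturals for convenience; only the values
    selected by the index types below are constrained. *)
Definition gap_idx : Type :=
  (int + {i : nat | (0 < i < p)%N} * int + {j : nat | (j <= p./2)%N})%type.

Definition gap_family (V : Type) (L : int -> V) (I : nat -> int -> V)
    (C : nat -> V) (t : gap_idx) : V :=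
  match t with
  | inl (inl n) => L n
  | inl (inr (i, n)) => I (val i) n
  | inr j => C (val j)
  end.

(** [I i n] stands for [I_n^(i)]. *)
Record is_gap_virasoro (g : lieAlgType K) (L : int -> g)
    (I : nat -> int -> g) (C : nat -> g) : Prop := {
  gap_basis : lbasis (gap_family L I C) ;
  gap_LL : forall m n : int,
    [` L m, L n] = (m - n)%:~R *: L (m + n)
      + (12%:R^-1 * (m ^+ 3 - m)%:~R * (m + n == 0)%:R) *: C 0%N ;
  gap_II : forall (i j : nat) (m n : int), (0 < i < p)%N -> (0 < j < p)%N ->
    [` I i m, I j n] =
      (ratr (pexp i m) * (i + j == p)%N%:R * (m + n + 1 == 0)%:R)
        *: fold_idx C i ;
  gap_LI : forall (i : nat) (m n : int), (0 < i < p)%N ->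
    [` L m, I i n] = - ratr (pexp i n) *: I i (m + n) ;
  gap_C : forall j : nat, (j <= p./2)%N -> central (C j)
}.

Definition tw_idx : Type :=
  ({i : nat | (i < p)%N} * int + {j : nat | (j <= p./2)%N})%type.

Definition tw_family (V : Type) (N : nat -> int -> V) (Kb : nat -> V)
    (t : tw_idx) : V :=
  match t with
  | inl (i, m) => N (val i) m
  | inr j => Kb (val j)
  end.

(** [Nbar_i(z) = \sum_m Nbar_i(m + i/p) z^(- m - i/p - 1)] and
    [Kbar_i(z) = Kbar_i(-1) z^0]; [N i m] stands for [Nbar_i(m + i/p)] and
    [Kb i] for [Kbar_i(-1)]. *)
Definition Nfield (V : lmodType K) (N : nat -> int -> V) (i : nat) : rat -> V :=
  fsum (fun m => - pexp i m - 1) (N i).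

Definition Kfield (V : lmodType K) (Kb : nat -> V) (i : nat) : rat -> V :=
  fconst (fold_idx Kb i).

(** [n] is the twisted Lie algebra N(sigma), given by its generating-function
    relations. *)
Record is_twisted_lie (n : lieAlgType K) (N : nat -> int -> n)
    (Kb : nat -> n) : Prop := {
  tw_basis : lbasis (tw_family N Kb) ;
  tw_K : forall j : nat, (j <= p./2)%N -> central (Kb j) ;
  tw_N0N0 :
    fbracket (Nfield N 0) (Nfield N 0) =
      mulw (deriv1 (Nfield N 0)) (delta_wz 0)
      + (2%:R : K) *: mulw (Nfield N 0) (deriv_w (delta_wz 0))
      + (12%:R^-1 : K) *:
          mulw (Kfield Kb 0) (deriv_w (deriv_w (deriv_w (delta_wz 0)))) ;
  tw_N0Ni : forall i : nat, (0 < i < p)%N ->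
    fbracket (Nfield N 0) (Nfield N i) =
      mulw (deriv1 (Nfield N i)) (delta_wz 0)
      + mulw (Nfield N i) (deriv_w (delta_wz 0)) ;
  tw_NiNj : forall i j : nat, (0 < i < p)%N -> (0 < j < p)%N ->
    fbracket (Nfield N i) (Nfield N j) =
      ((i + j == p)%N%:R : K) *:
        mulw (Kfield Kb i) (deriv_w (delta_wz (i%:R / p%:R)))
}.

Section Sub.
Variables (V : lmodType K) (J : set nat).

Definition gJ (L : int -> V) (I : nat -> int -> V) (C : nat -> V) : set V :=
  lspan (range L `|` [set I i n | i in J `\ 0%N & n in [set: int]]
         `|` [set C 0%N] `|` [set fold_idx C i | i in J `\ 0%N]).

Definition hJ (I : nat -> int -> V) (C : nat -> V) : set V :=
  lspan ([set I i n | i in J & n in [set: int]]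
         `|` [set fold_idx C i | i in J]).

Definition NJ (N : nat -> int -> V) (Kb : nat -> V) : set V :=
  lspan ([set N j m | j in J & m in [set: int]]
         `|` [set fold_idx Kb j | j in J]).

End Sub.

End GapVirasoro.

(* Main.v *)
Require Import Defs.
From HB Require Import structures.
From mathcomp Require Import all_boot all_order all_algebra.
From mathcomp Require Import all_classical all_reals.
From mathcomp Require Import complex zify ring lra.

Set Implicit Arguments.
Unset Strict Implicit.
Unset Printing Implicit Defensive.

Import GRing.Theory Num.Theory.
Local Open Scope classical_set_scope.
Local Open Scope ring_scope.

(** The map [theta] sends a basis bijectively onto a basis, so it exists, is
    unique and is a linear isomorphism; what has to be seen is that it preserves
    brackets, and by bilinearity it suffices to check this on the basis.

    The brackets of the basis of [n] are hidden in generating functions. They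
    become readable once the exponent of [z] is fixed: the coefficient of
    [z^(-a-1)] in [z^-1 (w/z)^s delta(w/z)] is the single monomial [w^a] when
    [a - s] is an integer. Derivatives in [w] preserve this shape, and
    multiplying a series in [w] by a monomial only shifts and scales it. Hence
    every relation can be read off coefficientwise, giving
    - [N_0(m), N_0(k)] = (m - k) N_0(m + k - 1)
        + m (m - 1) (m - 2) / 12 K_0 if m + k = 2   ([tw_bracket00]),
    - [N_0(m), N_i(k + i/p)] = - (k + i/p) N_i(m + k - 1 + i/p)
                                                   ([tw_bracket0i]),
    - [N_i(m + i/p), N_j(k + j/p)] = (m + i/p) K_i if i + j = p and
        m + k + 1 = 0                              ([tw_bracketij]).
    The substitution [m := m + 1] matches the first line with the Virasoro
    relation, because (m + 1) m (m - 1) = m^3 - m; this explains the shift in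
    [theta (N_0(m)) = L_(m-1)]. The same substitution turns the second line into
    the relation between [L_m] and [I_k^(i)], and the third is literally the
    relation between [I_m^(i)] and [I_k^(j)] ([gens_map_lie]).

    For the restrictions: the brackets above show that the span of the
    generators with indices in [J] is a subalgebra ([NJ_subalgebra]). A Lie
    algebra isomorphism restricts to an isomorphism of any subalgebra onto its
    image, and the image of a span is the span of the images, which here is
    [gJ] or [hJ] according to whether 0 belongs to [J] ([image_NJ_gJ],
    [image_NJ_hJ]). *)

(** * Spans and bases *)

Section Span.
Context {K : comNzRingType} {V : lmodType K}.
Implicit Types (S A : set V) (x y : V).

(** Scaling is merged with addition so that a single closure condition, in the
    form in which linearity is stated, has to be checked. *)
Lemma lspan_ind S A :
  A 0 -> (forall (a : K) x y, S x -> A y -> A (a *: x + y)) -> lspan S `<=` A.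
Proof.
move=> A0 AS x [m [c [s [Ss ->]]]].
by elim/big_rec: _ => // k y _ Ay; apply: AS.
Qed.

Lemma sub_lspan S : S `<=` lspan S.
Proof.
move=> x Sx; exists 1%N, (fun=> 1), (fun=> x); split=> //.
by rewrite big_ord1 scale1r.
Qed.

Lemma lspan0 S : lspan S 0.
Proof.
exists 0%N, (fun=> 0), (fun=> 0); split; first by case.
by rewrite big_ord0.
Qed.

Lemma lspanZ S (a : K) x : lspan S x -> lspan S (a *: x).
Proof.
move=> [m [c [s [Ss ->]]]]; exists m, (fun k => a * c k), s; split=> //.
by rewrite scaler_sumr; apply: eq_bigr => k _; rewrite scalerA.
Qed.

Lemma lspanD S x y : lspan S x -> lspan S y -> lspan S (x + y).
Proof.
move=> [m [c [s [Ss ->]]]] [m' [c' [s' [Ss' ->]]]].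
pose glue T (u : 'I_m -> T) (u' : 'I_m' -> T) (k : 'I_(m + m')) :=
  match fintype.split k with inl i => u i | inr j => u' j end.
have glueL T (u : 'I_m -> T) (u' : 'I_m' -> T) i :
    glue T u u' (lshift m' i) = u i.
  by rewrite /glue -[lshift _ _]/(unsplit (inl i)) unsplitK.
have glueR T (u : 'I_m -> T) (u' : 'I_m' -> T) j :
    glue T u u' (rshift m j) = u' j.
  by rewrite /glue -[rshift _ _]/(unsplit (inr j)) unsplitK.
exists (m + m')%N, (glue _ c c'), (glue _ s s'); split.
  by move=> k; rewrite /glue; case: (fintype.split k).
rewrite big_split_ord; congr (_ + _);
  by apply: eq_bigr => k _; rewrite ?glueL ?glueR.
Qed.

Lemma lspan_min S A :
  A 0 -> (forall x y, A x -> A y -> A (x + y)) ->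
  (forall (a : K) x, A x -> A (a *: x)) -> S `<=` A -> lspan S `<=` A.
Proof.
move=> A0 AD AZ SA; apply: lspan_ind => // a x y Sx Ay.
by apply: AD => //; apply/AZ/SA.
Qed.

End Span.

Lemma image_lspan (K : comNzRingType) (V W : lmodType K) (f : {linear V -> W})
    (S : set V) : f @` lspan S = lspan (f @` S).
Proof.
apply/seteqP; split=> [_ [x Sx <-]|].
  move: x Sx; apply: (lspan_min (A := f @^-1` lspan (f @` S))) => /=.
  - by rewrite linear0; apply: lspan0.
  - by move=> x y; rewrite linearD; apply: lspanD.
  - by move=> a x; rewrite linearZ; apply: lspanZ.
  - by move=> x Sx; apply: sub_lspan; exists x.
apply: lspan_min.
- by exists 0; [apply: lspan0|rewrite linear0].
- move=> _ _ [x Sx <-] [y Sy <-].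
  by exists (x + y); [apply: lspanD|rewrite linearD].
- move=> a _ [x Sx <-].
  by exists (a *: x); [apply: lspanZ|rewrite linearZ].
- by move=> _ [x Sx <-]; exists x => //; apply: sub_lspan.
Qed.

(** Linear combinations are indexed by lists, in which an index may be repeated:
    they are then closed under concatenation, whereas [lfree] speaks only of
    combinations with distinct indices. *)
Definition lcomb {K : comNzRingType} {V : lmodType K} {T : Type} (b : T -> V)
    (l : seq (K * T)) : V :=
  \sum_(x <- l) x.1 *: b x.2.

Section Extension.
Context {K : comNzRingType} {T : eqType}.
Implicit Types (V W : lmodType K) (l : seq (K * T)).

Lemma lcomb_cat V (b : T -> V) l l' :
  lcomb b (l ++ l') = lcomb b l + lcomb b l'.
Proof. exact: big_cat. Qed.

Lemma lcombZ V (b : T -> V) (a : K) l :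
  lcomb b [seq (a * x.1, x.2) | x <- l] = a *: lcomb b l.
Proof.
rewrite /lcomb big_map scaler_sumr.
by apply: eq_bigr => x _ /=; rewrite scalerA.
Qed.

(** Collecting the coefficients of equal indices yields a combination with
    distinct indices, to which [lfree] applies. *)
Lemma lcomb_collect V (b : T -> V) l :
  lcomb b l = \sum_(t <- undup [seq x.2 | x <- l])
                (\sum_(x <- l | x.2 == t) x.1) *: b t.
Proof.
under eq_bigr do rewrite scaler_suml big_mkcond.
rewrite exchange_big /=; apply: eq_big_seq => x xl.
have xu : x.2 \in undup [seq y.2 | y <- l] by rewrite mem_undup map_f.
rewrite (bigD1_seq _ xu (undup_uniq _)) /= eqxx big1 ?addr0 // => t.
by rewrite eq_sym => /negbTE ->.
Qed.

(** A relation among the values [F t] holds as soon as it holds among the free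
    [b t], since the latter forces all collected coefficients to vanish. This
    makes the extension of [F] from a basis independent of choices. *)
Lemma lfree_lcomb0 V W (b : T -> V) (F : T -> W) l :
  lfree b -> lcomb b l = 0 -> lcomb F l = 0.
Proof.
move=> freeb; rewrite (lcomb_collect b) (lcomb_collect F); set u := undup _.
rewrite big_tnth => bl0; rewrite big_tnth; apply: big1 => k _.
have inju : injective (tnth (in_tuple u)).
  exact/tuple_uniqP/undup_uniq.
by rewrite (freeb _ _ _ inju bl0) scale0r.
Qed.

Lemma lbasis_lcomb V (b : T -> V) x : lbasis b -> exists l, x = lcomb b l.
Proof.
case=> _ spanb; have : lspan (range b) x by rewrite spanb.
move: x; apply: lspan_ind; first by exists [::]; rewrite /lcomb big_nil.
by move=> a _ _ [t _ <-] [l ->]; exists ((a, t) :: l); rewrite /lcomb big_cons.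
Qed.

(** Choose an expansion of each vector in the basis and replace [b] by [F] in
    it; linearity follows because the result depends only on the vector. *)
Lemma lbasis_extension V W (b : T -> V) (F : T -> W) :
  lbasis b -> exists f : {linear V -> W}, forall t, f (b t) = F t.
Proof.
move=> basisb.
have [co coE] := choice (fun x => lbasis_lcomb x basisb).
pose phi x := lcomb F (co x).
have phiE l : phi (lcomb b l) = lcomb F l.
  apply/eqP; rewrite -subr_eq0 -scaleN1r -lcombZ -lcomb_cat; apply/eqP.
  apply: lfree_lcomb0 (proj1 basisb) _.
  by rewrite lcomb_cat lcombZ -coE scaleN1r subrr.
have phi_lin : linear phi.
  move=> a x y; rewrite [x in LHS]coE [y in LHS]coE -lcombZ -lcomb_cat phiE.
  by rewrite lcomb_cat lcombZ.
pose phiL := GRing.isLinear.Build K V W *:%R phi phi_lin.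
pose f : {linear V -> W} := HB.pack phi phiL.
exists f => t.
have one (U : lmodType K) (h : T -> U) : lcomb h [:: (1, t)] = h t.
  by rewrite /lcomb big_seq1 scale1r.
by rewrite -one /= -[RHS]one; apply: phiE.
Qed.

Lemma lbasis_unique V W (b : T -> V) (f f' : {linear V -> W}) :
  lbasis b -> (forall t, f (b t) = f' (b t)) -> f =1 f'.
Proof.
move=> basisb eqf x; have [l ->] := lbasis_lcomb x basisb.
rewrite /lcomb !linear_sum; apply: eq_bigr => t _.
by rewrite !linearZ /= eqf.
Qed.

End Extension.

(** * Lie algebras *)

Section LieBasics.
Context {K : comNzRingType}.
Implicit Types M : lieAlgType K.

Lemma lie0l M (y : M) : [` 0, y] = 0.
Proof.
by have := lie_linearl y (-1) 0 0; rewrite scaler0 addr0 scaleN1r addNr.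
Qed.

Lemma lie0r M (x : M) : [` x, 0] = 0.
Proof.
by have := lie_linearr x (-1) 0 0; rewrite scaler0 addr0 scaleN1r addNr.
Qed.

Lemma lieDl M (x x' y : M) : [` x + x', y] = [` x, y] + [` x', y].
Proof. by have := lie_linearl y 1 x x'; rewrite !scale1r. Qed.

Lemma lieDr M (x y y' : M) : [` x, y + y'] = [` x, y] + [` x, y'].
Proof. by have := lie_linearr x 1 y y'; rewrite !scale1r. Qed.

Lemma lieN M (x y : M) : [` x, y] = - [` y, x].
Proof.
apply/eqP; rewrite -addr_eq0; apply/eqP.
by have := liexx (x + y); rewrite lieDl !lieDr !liexx add0r addr0.
Qed.

Lemma central_lier M (c x : M) : central c -> [` x, c] = 0.
Proof. by move=> cc; rewrite lieN cc oppr0. Qed.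

Lemma lie_hom_on_basis (T : eqType) (M M' : lieAlgType K) (b : T -> M)
    (f : {linear M -> M'}) :
  lbasis b -> (forall s t, f [` b s, b t] = [` f (b s), f (b t)]) ->
  forall x y, f [` x, y] = [` f x, f y].
Proof.
move=> basisb fb.
have fbl s y : f [` b s, y] = [` f (b s), f y].
  have [l ->] := lbasis_lcomb y basisb; rewrite /lcomb.
  elim/big_rec: _ => [|t y' _ IH]; first by rewrite linear0 !lie0r linear0.
  by rewrite lie_linearr linearP IH fb linearP lie_linearr.
move=> x y; have [l ->] := lbasis_lcomb x basisb; rewrite /lcomb.
elim/big_rec: _ => [|t x' _ IH]; first by rewrite linear0 !lie0l linear0.
by rewrite lie_linearl linearP IH fbl linearP lie_linearl.
Qed.

Lemma lie_subalgebra_lspan M (S : set M) :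
  (forall x y, S x -> S y -> lspan S [` x, y]) -> lie_subalgebra (lspan S).
Proof.
move=> Sbr; split=> [|x y|a x|x y]; first exact: lspan0.
- exact: lspanD.
- exact: lspanZ.
move=> Sx Sy; move: x Sx; apply: lspan_ind.
  by rewrite lie0l; apply: lspan0.
move=> a x x' Sx Ax'; rewrite lie_linearl; apply: lspanD => //.
apply: lspanZ; move: y Sy {Ax'}; apply: lspan_ind.
  by rewrite lie0r; apply: lspan0.
move=> c y y' Sy Ay'; rewrite lie_linearr; apply: lspanD => //.
by apply/lspanZ/Sbr.
Qed.

Lemma lie_isomorphism_restrict (M M' : lieAlgType K) (f : {linear M -> M'})
    (A : set M) :
  lie_isomorphism f -> lie_subalgebra A ->
  restricts_to_lie_isomorphism f A (f @` A).
Proof.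
move=> [fbr /bij_inj injf] subA; have [A0 AD AZ Abr] := subA; split=> //.
- split.
  + by exists 0; rewrite ?linear0.
  + by move=> _ _ [x Ax <-] [y Ay <-]; exists (x + y); rewrite ?linearD; auto.
  + by move=> a _ [x Ax <-]; exists (a *: x); rewrite ?linearZ; auto.
  + by move=> _ _ [x Ax <-] [y Ay <-]; exists [` x, y]; rewrite ?fbr; auto.
- by split=> [x Ax|x y _ _ /injf|//]; first by exists x.
Qed.

End LieBasics.

(** * Coefficients of the generating functions *)

(** The conventions K_i = K_(p-i) and C_i = C_(p-i) agree under [h]: for
    [i < p], folding always lands in the range where [h] is known. *)
Lemma fold_idx_map (T U : Type) (h : T -> U) (p : nat) (A : nat -> T)
    (B : nat -> U) (i : nat) :
  (i < p)%N -> (forall j, (j <= p./2)%N -> h (A j) = B j) ->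
  h (fold_idx p A i) = fold_idx p B i.
Proof.
move=> ip hAB; rewrite /fold_idx.
by case: (leqP i p./2) => hi; apply: hAB => //; lia.
Qed.

Section Coefficients.
Context {K : numFieldType}.
Implicit Types (V : lmodType K) (d : rat -> rat -> K).

Lemma fsumE V (e : int -> rat) (v : int -> V) m :
  injective e -> fsum e v (e m) = v m.
Proof.
move=> inje; rewrite /fsum (_ : [set k | e k = e m] = [set m]) ?fsbig_set1 //.
by apply/seteqP; split=> [k /inje|k ->].
Qed.

(** The coefficient of [z^q] in [d] is the monomial [c w^t]. *)
Definition monomial_in_w d (q : rat) (c : K) (t : rat) : Prop :=
  forall r, d q r = c * (r == t)%:R.

Lemma monomial_in_w_delta (s : rat) (m : int) :
  monomial_in_w (@delta_wz K s) (- (m%:~R + s) - 1) 1 (m%:~R + s).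
Proof.
move=> r; rewrite /delta_wz /mulmono /subst_wz mul1r subr0.
rewrite (_ : (_ == _ :> rat) = (r == m%:~R + s)); last first.
  by apply/eqP/eqP => h; lra.
case: eqP => // ->; rewrite addrK /delta.
by rewrite (fsumE (V := K^o)) // => i j /eqP; rewrite eqr_int => /eqP.
Qed.

Lemma monomial_in_w_deriv d q c t :
  monomial_in_w d q c t -> monomial_in_w (deriv_w d) q (c * ratr t) (t - 1).
Proof.
move=> dq r; rewrite /deriv_w dq -(subr_eq r) opprK.
by case: eqP => [->|_]; rewrite ?mulr1 ?mulr0 // mulrC.
Qed.

Lemma mulw_monomial V (a : rat -> V) d q c t r :
  monomial_in_w d q c t -> mulw a d q r = c *: a (r - t).
Proof.
move=> dq; rewrite /mulw -(fsbig_widen [set t]) ?fsbig_set1.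
- by rewrite dq eqxx mulr1.
- by [].
- by move=> u [_ /= /eqP/negbTE nu]; rewrite dq nu mulr0 scale0r.
Qed.

End Coefficients.

(** * Brackets of the basis of the twisted Lie algebra *)

Section TwistedBrackets.
Context {K : numFieldType} {p : nat} {n : lieAlgType K}.
Context {N : nat -> int -> n} {Kb : nat -> n} (hn : is_twisted_lie p N Kb).

Lemma pexp_inj i : injective (fun m => - pexp p i m - 1).
Proof.
by move=> m k /addIr /oppr_inj /addIr /eqP; rewrite eqr_int => /eqP.
Qed.

Lemma NfieldE i m : Nfield p N i (- pexp p i m - 1) = N i m.
Proof. exact: (fsumE (N i) m (@pexp_inj i)). Qed.

Lemma pexp0 m : pexp p 0 m = m%:~R.
Proof. by rewrite /pexp mul0r addr0. Qed.

(** Here [q] and [r] are the exponents at which the two fields have coefficients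
    [N_0(m)] and [N_0(k)]. The term with the derivative of [N_0(w)] contributes
    - (m + k), the middle one 2 m, which add up to m - k. *)
Lemma tw_bracket00 (m k : int) :
  [` N 0%N m, N 0%N k] = (m - k)%:~R *: N 0%N (m + k - 1)
    + (12%:R^-1 * (m * (m - 1) * (m - 2))%:~R * (m + k == 2)%:R) *: Kb 0%N.
Proof.
pose q : rat := - pexp p 0 m - 1; pose r : rat := - pexp p 0 k - 1.
have d0 : monomial_in_w (@delta_wz K 0) q 1 (m%:~R).
  by have := monomial_in_w_delta (K := K) 0 m; rewrite /q pexp0 !addr0.
have d1 := monomial_in_w_deriv d0.
have d3 := monomial_in_w_deriv (monomial_in_w_deriv d1).
have : fbracket (Nfield p N 0) (Nfield p N 0) q r =
    mulw (deriv1 (Nfield p N 0)) (delta_wz 0) q r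
    + 2%:R *: mulw (Nfield p N 0) (deriv_w (delta_wz 0)) q r
    + 12%:R^-1 *:
        mulw (Kfield p Kb 0) (deriv_w (deriv_w (deriv_w (delta_wz 0)))) q r.
  by rewrite (tw_N0N0 hn).
rewrite /fbracket !NfieldE => ->.
rewrite (mulw_monomial _ _ d0) (mulw_monomial _ _ d1).
rewrite (mulw_monomial _ _ d3) /deriv1.
have -> : r - m%:~R + 1 = - pexp p 0 (m + k - 1) - 1.
  by rewrite /r !pexp0; ring.
have -> : r - (m%:~R - 1) = - pexp p 0 (m + k - 1) - 1.
  by rewrite /r !pexp0; ring.
rewrite NfieldE /Kfield /fconst.
have -> : (r - (m%:~R - 1 - 1 - 1) == 0) = (m + k == 2).
  rewrite /r pexp0 -(inj_eq (intr_inj (R := rat))); apply/eqP/eqP => h.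
    by rewrite intrD; lra.
  by rewrite intrD in h; lra.
rewrite !pexp0.
rewrite !(rmorphB, rmorphN, rmorphD, rmorphM, rmorph1, ratr_int) /= ?ratr_int.
rewrite !scalerA -scalerDl; congr (_ *: _ + _); first by ring.
rewrite /fold_idx /=; case: eqP => _; last by rewrite scaler0 mulr0 scale0r.
by rewrite mulr1; congr (_ *: _); ring.
Qed.

(** The two terms contribute - (m + k + i/p) and m, so that m cancels. *)
Lemma tw_bracket0i (i : nat) (m k : int) : (0 < i < p)%N ->
  [` N 0%N m, N i k] = - ratr (pexp p i k) *: N i (m + k - 1).
Proof.
move=> hi; pose q : rat := - pexp p 0 m - 1; pose r : rat := - pexp p i k - 1.
have d0 : monomial_in_w (@delta_wz K 0) q 1 (m%:~R).
  by have := monomial_in_w_delta (K := K) 0 m; rewrite /q pexp0 !addr0.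
have d1 := monomial_in_w_deriv d0.
have : fbracket (Nfield p N 0) (Nfield p N i) q r =
    mulw (deriv1 (Nfield p N i)) (delta_wz 0) q r
    + mulw (Nfield p N i) (deriv_w (delta_wz 0)) q r.
  by rewrite (tw_N0Ni hn).
rewrite /fbracket !NfieldE => ->.
rewrite (mulw_monomial _ _ d0).
rewrite (mulw_monomial _ _ d1) /deriv1.
have -> : r - m%:~R + 1 = - pexp p i (m + k - 1) - 1.
  by rewrite /r /pexp; ring.
have -> : r - (m%:~R - 1) = - pexp p i (m + k - 1) - 1.
  by rewrite /r /pexp; ring.
rewrite NfieldE /pexp.
rewrite !(rmorphB, rmorphN, rmorphD, rmorphM, rmorph1, ratr_int) /= ?ratr_int.
rewrite !scalerA -scalerDl; congr (_ *: _); ring.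
Qed.

Lemma tw_bracketij (i j : nat) (m k : int) :
  (0 < i < p)%N -> (0 < j < p)%N ->
  [` N i m, N j k] =
    (ratr (pexp p i m) * (i + j == p)%N%:R * (m + k + 1 == 0)%:R)
      *: fold_idx p Kb i.
Proof.
move=> hi hj.
pose q : rat := - pexp p i m - 1; pose r : rat := - pexp p j k - 1.
have d1 := monomial_in_w_deriv (monomial_in_w_delta (K := K) (i%:R / p%:R) m).
have : fbracket (Nfield p N i) (Nfield p N j) q r =
    (i + j == p)%N%:R *:
      mulw (Kfield p Kb i) (deriv_w (delta_wz (i%:R / p%:R))) q r.
  by rewrite (tw_NiNj hn).
rewrite /fbracket !NfieldE => ->.
rewrite (mulw_monomial _ _ d1) /Kfield /fconst scalerA.
case: (eqVneq (i + j)%N p) => [ijp|_]; last by rewrite mulr0 !mul0r !scale0r.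
(* As i/p + j/p = 1, the exponent of [w] vanishes exactly when
   [m + k + 1 = 0]. *)
have jp : j%:R / p%:R = 1 - i%:R / p%:R :> rat.
  rewrite -ijp natrD; field; rewrite -natrD pnatr_eq0; lia.
have -> : (r - (m%:~R + i%:R / p%:R - 1) == 0) = (m + k + 1 == 0).
  rewrite /r /pexp jp -(inj_eq (intr_inj (R := rat))); apply/eqP/eqP => h.
    by rewrite !intrD; lra.
  by rewrite !intrD in h; lra.
rewrite /pexp !mulr1 !mul1r.
by case: eqP => _; rewrite ?mulr1 // mulr0 scale0r scaler0.
Qed.

(** By the three formulas, every generator occurring in the bracket of two
    generators carries the index of one of them. *)
Lemma NJ_subalgebra (J : set nat) :
  J `<=` [set i | (i < p)%N] -> lie_subalgebra (NJ p J N Kb).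
Proof.
move=> Jp; apply: lie_subalgebra_lspan; set S := (X in lspan X).
have SN i m : J i -> lspan S (N i m).
  by move=> Ji; apply: sub_lspan; left; exists i => //; exists m.
have SK i : J i -> lspan S (fold_idx p Kb i).
  by move=> Ji; apply: sub_lspan; right; exists i.
have Kc i : J i -> central (fold_idx p Kb i).
  move=> /Jp /= ip; rewrite /fold_idx; case: ifP => hi; apply: (tw_K hn) => //.
  lia.
have pos i : J i -> i != 0%N -> (0 < i < p)%N.
  by move=> /Jp /= ->; rewrite lt0n => ->.
move=> x y Sx [[j Jj [k _ <-]]|[j Jj <-]]; last first.
  by rewrite (central_lier _ (Kc _ Jj)); apply: lspan0.
case: Sx => [[i Ji [m _ <-]]|[i Ji <-]]; last first.
  by rewrite Kc //; apply: lspan0.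
have [i0|/(pos _ Ji) hi] := eqVneq i 0%N.
  have [j0|/(pos _ Jj) hj] := eqVneq j 0%N; last first.
    by rewrite i0 tw_bracket0i //; apply/lspanZ/SN.
  rewrite i0 j0 tw_bracket00; rewrite i0 in Ji.
  by apply: lspanD; apply: lspanZ; [apply: SN|have := SK _ Ji].
have [j0|/(pos _ Jj) hj] := eqVneq j 0%N.
  by rewrite j0 lieN tw_bracket0i // -scaleN1r; do 2![apply: lspanZ]; apply: SN.
by rewrite tw_bracketij //; apply/lspanZ/SK.
Qed.

End TwistedBrackets.

(** * The isomorphism *)

Section Comparison.
Context {K : numFieldType} {p : nat}.
Context {g : lieAlgType K} {L : int -> g} {I : nat -> int -> g} {C : nat -> g}.
Context (hg : is_gap_virasoro p L I C).
Context {n : lieAlgType K} {N : nat -> int -> n} {Kb : nat -> n}.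
Context (hn : is_twisted_lie p N Kb).

Definition gens_map (theta : {linear n -> g}) : Prop :=
    [/\ (forall m : int, theta (N 0%N m) = L (m - 1)),
        (forall (i : nat) (m : int), (0 < i < p)%N ->
            theta (N i m) = I i m) &
        (forall j : nat, (j <= p./2)%N -> theta (Kb j) = C j)].

Lemma gens_map_unique theta theta' :
  gens_map theta -> gens_map theta' -> theta' =1 theta.
Proof.
move=> [t0 ti tK] [t0' ti' tK']; apply: lbasis_unique (tw_basis hn) _.
move=> [[[[|i] hi] m]|[j hj]] /=; first by rewrite t0 t0'.
  by rewrite ti ?ti'.
by rewrite tK ?tK'.
Qed.

Lemma gens_map_exists : (1 < p)%N -> exists theta, gens_map theta.
Proof.
move=> hp.
pose F (t : tw_idx p) : g := match t with
  | inl (i, m) => if val i == 0%N then L (m - 1) else I (val i) m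
  | inr j => C (val j)
  end.
have [theta thetaE] := lbasis_extension F (tw_basis hn).
have p0 : (0 < p)%N by lia.
exists theta; split=> [m|i m hi|j hj].
- exact: (thetaE (inl (exist _ 0%N p0, m))).
- have ip : (i < p)%N by case/andP: hi.
  have := thetaE (inl (exist _ i ip, m)); rewrite /= => ->.
  by case: eqP hi => // ->.
- exact: (thetaE (inr (exist _ j hj))).
Qed.

(** The inverse is the linear extension of the inverse correspondence between
    the two bases. *)
Lemma gens_map_bijective theta : gens_map theta -> bijective theta.
Proof.
move=> [t0 ti tK].
pose F (t : gap_idx p) : n := match t with
  | inl (inl m) => N 0%N (m + 1)
  | inl (inr (i, m)) => N (val i) m
  | inr j => Kb (val j)
  end.
have [psi psiE] := lbasis_extension F (gap_basis hg).
have pL m : psi (L m) = N 0%N (m + 1) by exact: (psiE (inl (inl m))).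
have pI i m (hi : (0 < i < p)%N) : psi (I i m) = N i m.
  exact: (psiE (inl (inr (exist _ i hi, m)))).
have pC j (hj : (j <= p./2)%N) : psi (C j) = Kb j.
  exact: (psiE (inr (exist _ j hj))).
exists psi.
- apply: (lbasis_unique (f := psi \o theta) (f' := idfun) (tw_basis hn)).
  move=> [[[[|i] hi] m]|[j hj]] /=; first by rewrite t0 pL subrK.
    by rewrite ti // pI.
  by rewrite tK // pC.
- apply: (lbasis_unique (f := theta \o psi) (f' := idfun) (gap_basis hg)).
  move=> [[m|[[i hi] m]]|[j hj]] /=; first by rewrite pL t0 addrK.
    by rewrite pI // ti.
  by rewrite pC // tK.
Qed.

Lemma gens_map_lie theta : gens_map theta ->
  forall x y, theta [` x, y] = [` theta x, theta y].
Proof.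
move=> [t0 ti tK]; apply: lie_hom_on_basis (tw_basis hn) _.
have tKf i : (i < p)%N -> theta (fold_idx p Kb i) = fold_idx p C i.
  by move=> ip; apply: fold_idx_map.
(* Stated apart because the case of [N_i] and [N_0] follows from it by
   antisymmetry. *)
have b0i i m k : (0 < i < p)%N ->
    theta [` N 0%N m, N i k] = [` theta (N 0%N m), theta (N i k)].
  move=> hi; rewrite (tw_bracket0i hn) // linearZ /= t0 !ti // (gap_LI hg) //.
  by congr (_ *: I _ _); ring.
case=> [[[i hi] m]|[j hj]]; last first.
  move=> t /=; rewrite (tw_K hn) // linear0 tK //.
  by rewrite (gap_C hg).
case=> [[[j hj] k]|[j hj]] /=; last first.
  rewrite (central_lier _ (tw_K hn hj)) linear0 tK //.
  by rewrite (central_lier _ (gap_C hg hj)).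
case: i hi => [_|i hi]; case: j hj => [_|j hj].
- rewrite (tw_bracket00 hn) linearD !linearZ /= !t0 tK // (gap_LL hg).
  (* The Virasoro cocycle at m - 1: (m - 1)^3 - (m - 1) = m (m - 1) (m - 2). *)
  congr (_ *: L _ + (_ * _ * _%:R) *: _).
  + by congr (_%:~R); ring.
  + by ring.
  + by congr (_%:~R); ring.
  + by congr (nat_of_bool _); apply/eqP/eqP; lia.
- exact: b0i.
- by rewrite lieN linearN b0i // -lieN.
- rewrite (tw_bracketij hn) // linearZ /= !ti // (gap_II hg) //.
  by rewrite tKf // ltnW.
Qed.

Lemma image_NJ_gJ theta (J : set nat) : gens_map theta ->
  J `<=` [set i | (i < p)%N] -> J 0%N ->
  theta @` NJ p J N Kb = gJ p J L I C.
Proof.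
move=> [t0 ti tK] Jp J0; rewrite /NJ image_lspan; congr lspan.
have tKf i : J i -> theta (fold_idx p Kb i) = fold_idx p C i.
  by move=> /Jp ip; apply: fold_idx_map.
have pos i : J i -> i <> 0%N -> (0 < i < p)%N.
  by move=> /Jp /= -> /eqP; rewrite lt0n => ->.
apply/seteqP; split=> x /=.
  move=> [_ [[i Ji [m _ <-]]|[i Ji <-]] <-].
    have [->|/eqP i0] := eqVneq i 0%N; first by do 3!left; exists (m - 1).
    do 2!left; right; exists i => //; exists m => //.
    by rewrite ti //; apply: pos.
  rewrite tKf //.
  have [->|/eqP i0] := eqVneq i 0%N; first by left; right.
  by right; exists i.
move=> [[[[m _ <-]|[i [Ji i0] [m _ <-]]]|->]|[i [Ji i0] <-]].
- exists (N 0%N (m + 1)); last by rewrite t0 addrK.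
  by left; exists 0%N => //; exists (m + 1).
- exists (N i m); last by rewrite ti //; apply: pos.
  by left; exists i => //; exists m.
- exists (fold_idx p Kb 0); last by rewrite tKf.
  by right; exists 0%N.
- exists (fold_idx p Kb i); last by rewrite tKf.
  by right; exists i.
Qed.

Lemma image_NJ_hJ theta (J : set nat) : gens_map theta ->
  J `<=` [set i | (i < p)%N] -> ~ J 0%N ->
  theta @` NJ p J N Kb = hJ p J I C.
Proof.
move=> [t0 ti tK] Jp J0; rewrite /NJ image_lspan; congr lspan.
have tKf i : J i -> theta (fold_idx p Kb i) = fold_idx p C i.
  by move=> /Jp ip; apply: fold_idx_map.
have tN i m : J i -> theta (N i m) = I i m.
  move=> Ji; apply: ti; rewrite (Jp _ Ji) andbT lt0n.
  by apply/eqP => i0; apply: J0; rewrite -i0.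
apply/seteqP; split=> x /=.
  move=> [_ [[i Ji [m _ <-]]|[i Ji <-]] <-].
    by left; exists i => //; exists m => //; rewrite tN.
  by right; exists i => //; rewrite tKf.
move=> [[i Ji [m _ <-]]|[i Ji <-]].
- by exists (N i m); [left; exists i => //; exists m|rewrite tN].
- by exists (fold_idx p Kb i); [right; exists i|rewrite tKf].
Qed.

End Comparison.


Theorem lemma6p5 (R : realType) (p : nat) (hp : (1 < p)%N)
    (g : lieAlgType R[i]) (L : int -> g) (I : nat -> int -> g) (C : nat -> g)
    (hg : is_gap_virasoro p L I C)
    (n : lieAlgType R[i]) (N : nat -> int -> n) (Kb : nat -> n)
    (hn : is_twisted_lie p N Kb) :
  let determines (theta : {linear n -> g}) :=
    [/\ (forall m : int, theta (N 0%N m) = L (m - 1)),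
        (forall (i : nat) (m : int), (0 < i < p)%N ->
            theta (N i m) = I i m) &
        (forall j : nat, (j <= p./2)%N -> theta (Kb j) = C j)] in
  exists theta : {linear n -> g},
    [/\ determines theta,
        (forall theta' : {linear n -> g}, determines theta' -> theta' =1 theta),
        lie_isomorphism theta &
        forall J : set nat,
          J `<=` [set i | (i < p)%N] ->
          (forall i : nat, (J `\ 0%N) i -> J (p - i)%N) ->
          (J <> J `\ 0%N ->
             restricts_to_lie_isomorphism theta (NJ p J N Kb) (gJ p J L I C)) /\
          (J = J `\ 0%N ->
             restricts_to_lie_isomorphism theta (NJ p J N Kb) (hJ p J I C))].
Proof.
move=> determines.
have [theta thetaG] := gens_map_exists (L := L) (I := I) (C := C) hn hp.
have iso : lie_isomorphism theta.
  split; first exact: (gens_map_lie hg hn thetaG).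
  exact: (gens_map_bijective hg hn thetaG).
exists theta; split=> // [theta' thetaG'|J Jp _].
  exact: (gens_map_unique hn thetaG thetaG').
have sub := lie_isomorphism_restrict iso (NJ_subalgebra hn Jp).
split=> JJ.
  rewrite -(image_NJ_gJ thetaG Jp) //.
  apply: contrapT => J0; apply: JJ; apply/seteqP; split=> [i Ji|i []//].
  by split=> // i0; apply: J0; rewrite -i0.
rewrite -(image_NJ_hJ thetaG Jp) //.
by rewrite JJ => -[_]; apply.
Qed.
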